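(* Let $G$ satisfy Condition 1, let the admissible input functions satisfy $\bigcap_{j=1}^kX_j\neq\emptyset$, and let the non-faulty agents run Algorithm 2 with step sizes as in the context, from arbitrary initial states and against arbitrary behavior of the faulty agents. Then there exists $x^*\in X$ such that for every non-faulty agent $i$, $\lim_{t\to\infty}|x_i(t)-x^*|=0$.
   Context: A synchronous system of $n$ agents communicates over a directed graph $G=(\mathcal{V},\mathcal{E})$, $\mathcal{V}=\{1,\dots,n\}$, without self-loops; $N_i^-=\{j:(j,i)\in\mathcal{E}\}$. At most $f$ agents are Byzantine faulty (may send arbitrary, possibly inconsistent values); $\mathcal{F}$ is the set of faulty agents. A function $h:\mathbb{R}\to\mathbb{R}$ is admissible if it is convex, $L$-Lipschitz, and $\arg\min h$ is nonempty and compact. Given admissible $h_1,\dots,h_k$ and an assignment matrix $\mathbf{A}\in\mathbb{R}^{k\times n}$ with nonnegative entries and columns summing to $1$, agent $i$ holds $g_i(x)=\sum_{j=1}^k\mathbf{A}_{ji}h_j(x)$ (agents do not know $\mathbf{A}$). Let $X_j=\arg\min h_j$ and $X=\arg\min h$ with $h=\frac1k\sum_{j=1}^kh_j$. Sparsity parameter $sp(\mathbf{A})$: smallest $s$ such that the sum of any $s$ columns of $\mathbf{A}$ is component-wise positive ($n+1$ if the sum of all columns is not). Reduced graph w.r.t. a set $\mathcal{F}'$ with $|\mathcal{F}'|\le f$: subgraph of $G$ obtained by removing the nodes of $\mathcal{F}'$ with their edges and then up to $f$ additional incoming edges at each remaining node. Source component: set of nodes of a graph each having a directed path to every other node of that graph.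 Condition 1: for every $\mathcal{F}'\subseteq\mathcal{V}$ with $|\mathcal{F}'|\le f$, every reduced graph w.r.t. $\mathcal{F}'$ has a source component with at least $\max\{f+1,sp(\mathbf{A})\}$ nodes. Step sizes: $\alpha(t)\ge0$ with $\alpha(t+1)\le\alpha(t)$ for all $t\ge0$, $\sum_{t}\alpha(t)=\infty$, $\sum_t\alpha^2(t)<\infty$. Algorithm 2: each non-faulty agent $i$ starts with an arbitrary $x_i(0)\in\mathbb{R}$; in iteration $t\ge1$ it sends $x_i(t-1)$ on all outgoing edges, receives the multiset of $|N_i^-|$ values on its incoming edges (a default value replaces any missing message), sorts them, discards the $f$ smallest and $f$ largest values (ties broken arbitrarily), lets $N_i^*(t)$ be the set of agents from which the remaining $|N_i^-|-2f$ values came with $w_j$ the value received from $j$, sets $w_i=x_i(t-1)$, and updates $x_i(t)=\frac{1}{|N_i^*(t)|+1}\sum_{j\in\{i\}\cup N_i^*(t)}w_j-\alpha(t-1)d_i(t-1)$, where $d_i(t-1)$ is a subgradient of $g_i$ at $x_i(t-1)$. *)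

(* Defs.v *)
From HB Require Import structures.
From mathcomp Require Import all_boot all_order all_algebra.
From mathcomp Require Import all_classical all_reals all_analysis.
Set Implicit Arguments. Unset Strict Implicit. Unset Printing Implicit Defensive.
Import Order.TTheory GRing.Theory Num.Theory.
Import numFieldNormedType.Exports.
Local Open Scope classical_set_scope.
Local Open Scope ring_scope.

Section Defs.
Variable R : realType.

Definition argmin (h : R -> R) : set R := [set x | forall y, h x <= h y].

Definition convex_fun (h : R -> R) : Prop :=
  forall (x y t : R), 0 <= t -> t <= 1 ->
    h (t * x + (1 - t) * y) <= t * h x + (1 - t) * h y.

Definition lipschitz_with (L : R) (h : R -> R) : Prop :=
  forall x y : R, `|h x - h y| <= L * `|x - y|.

Definition admissible (L : R) (h : R -> R) : Prop :=
  [/\ convex_fun h, lipschitz_with L h, argmin h !=set0 & compact (argmin h)].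

Definition subgradient (g : R -> R) (x d : R) : Prop :=
  forall y, g x + d * (y - x) <= g y.

Definition assignment_matrix (k n : nat) (A : 'M[R]_(k, n)) : Prop :=
  (forall j i, 0 <= A j i) /\ (forall i : 'I_n, \sum_(j < k) A j i = 1).

Definition sp_ok (k n : nat) (A : 'M[R]_(k, n)) (s : nat) : bool :=
  [forall S : {set 'I_n}, (#|S| == s) ==> [forall j : 'I_k, 0 < \sum_(i in S) A j i]].

(* sparsity parameter: smallest such s (among 0..n), or n+1 if none *)
Definition sp (k n : nat) (A : 'M[R]_(k, n)) : nat :=
  \big[minn/n.+1]_(s < n.+1 | sp_ok A s) s.

Definition local_cost (k n : nat) (A : 'M[R]_(k, n)) (h : 'I_k -> R -> R)
  (i : 'I_n) (x : R) : R := \sum_(j < k) A j i * h j x.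

Definition avg_cost (k : nat) (h : 'I_k -> R -> R) (x : R) : R :=
  k%:R^-1 * \sum_(j < k) h j x.

End Defs.

Local Close Scope classical_set_scope.
Section Graphs.
Variable n : nat.

Definition no_self_loops (E : rel 'I_n) : Prop := forall i, ~~ E i i.

Definition in_nbrs (E : rel 'I_n) (i : 'I_n) : {set 'I_n} := [set j | E j i].

(* E' is (the edge relation of) a reduced graph of E w.r.t. F' (with
   |F'| <= f): its node set is V \ F', its edges are edges of E between
   remaining nodes, and at each remaining node at most f further incoming
   edges (from remaining nodes) have been removed. *)
Definition reduced_graph (f : nat) (E : rel 'I_n) (F' : {set 'I_n})
  (E' : rel 'I_n) : Prop :=
  (forall u v, E' u v -> [/\ E u v, u \notin F' & v \notin F']) /\
  (forall v, v \notin F' ->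
     #|[set u | [&& E u v, u \notin F' & ~~ E' u v]]| <= f)%N.

Definition restr_rel (F' : {set 'I_n}) (E' : rel 'I_n) : rel 'I_n :=
  fun u v => [&& E' u v, u \notin F' & v \notin F'].

Definition source_component (F' : {set 'I_n}) (E' : rel 'I_n) : {set 'I_n} :=
  [set u | (u \notin F') &&
           [forall v, (v \notin F') ==> connect (restr_rel F' E') u v]].

Definition condition1 (R : realType) (k f : nat) (E : rel 'I_n)
  (A : 'M[R]_(k, n)) : Prop :=
  forall F' : {set 'I_n}, (#|F'| <= f)%N ->
    forall E' : rel 'I_n, reduced_graph f E F' E' ->
      (maxn f.+1 (sp A) <= #|source_component F' E'|)%N.

(* Trimming step: from the received values w (indexed by in-neighbours
   Nin), the f smallest (set Lo) and f largest (set Hi) are discarded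
   (ties broken arbitrarily); Nstar is the set of remaining senders. *)
Definition trimmed (R : realType) (f : nat) (Nin : {set 'I_n})
  (w : 'I_n -> R) (Nstar : {set 'I_n}) : Prop :=
  exists Lo Hi : {set 'I_n},
    [/\ Lo \subset Nin, Hi \subset Nin & [disjoint Lo & Hi]] /\
    [/\ #|Lo| = f, #|Hi| = f & Nstar = Nin :\: (Lo :|: Hi)] /\
        [/\ forall l m, l \in Lo -> m \in Nstar -> w l <= w m,
            forall m h, m \in Nstar -> h \in Hi -> w m <= w h &
            forall l h, l \in Lo -> h \in Hi -> w l <= w h].

End Graphs.

(* x t i : state of agent i after iteration t (x 0 = initial state);
   msg t j i : value that (faulty) agent j sends to i in iteration t;
   Nst t i : the set N_i^*(t); d t i : subgradient used in iteration t+1.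
   Only the states of non-faulty agents are meaningful. *)
Definition received (R : realType) (n : nat) (F : {set 'I_n})
  (x : nat -> 'I_n -> R) (msg : nat -> 'I_n -> 'I_n -> R)
  (t : nat) (i j : 'I_n) : R :=
  if j \in F then msg t j i else x t.-1 j.

Definition algorithm2_run (R : realType) (n k f : nat) (E : rel 'I_n)
  (A : 'M[R]_(k, n)) (h : 'I_k -> R -> R) (F : {set 'I_n})
  (alpha : nat -> R) (x : nat -> 'I_n -> R)
  (msg : nat -> 'I_n -> 'I_n -> R) (Nst : nat -> 'I_n -> {set 'I_n})
  (d : nat -> 'I_n -> R) : Prop :=
  forall t : nat, forall i : 'I_n, i \notin F ->
    [/\ trimmed f (in_nbrs E i) (received F x msg t.+1 i) (Nst t.+1 i),
        subgradient (local_cost A h i) (x t i) (d t i) &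
        x t.+1 i =
          (#|Nst t.+1 i|%:R + 1)^-1 *
            (x t i + \sum_(j in Nst t.+1 i) received F x msg t.+1 i j)
          - alpha t * d t i].

(* Main.v *)
(** The update at a non-faulty node averages its own state with values all lying in the current range [lo, hi] of non-faulty states, and all but f of the non-faulty in-neighbours pull the average away from both ends of that range by a fixed fraction b of their own distance to it. So the pulling edges form a reduced graph at every step, and Condition 1 applies to it.

Tracing pulling edges backwards in time, a set of ancestors that stops growing is closed under predecessors, hence contains the source component of the reduced graph. Two consequences: any two nodes have a common ancestor 2n steps earlier, so the spread of the states contracts up to O(alpha) and tends to 0; and every node has, within n steps, an ancestor i with A j i > 0, for each j.

Fix a common minimizer z. In dimension one a subgradient step at a state above z never increases it, and a state below z may overshoot the current maximum B only if B < z + (L/b) alpha; hence any bound B >= z + (L/b) alpha(t) on the states at time t persists. Together with the vanishing spread this forces convergence to some p. If h_j(z) < h_j(p), all states eventually lie on one side of z, all steps go towards z, and the agents with A j i > 0 move by at least a constant times alpha; this propagates to all agents every n+1 steps, which contradicts the divergence of the series of alpha. *)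
Require Import Defs.
From HB Require Import structures.
From mathcomp Require Import all_boot all_order all_algebra.
From mathcomp Require Import all_classical all_reals all_analysis.
From mathcomp Require Import zify ring lra.
Set Implicit Arguments. Unset Strict Implicit. Unset Printing Implicit Defensive.
Import Order.TTheory GRing.Theory Num.Theory.
Import numFieldNormedType.Exports.
Local Open Scope classical_set_scope.
Local Open Scope ring_scope.

(** * Ancestors under time-varying relations *)

Section Ancestors.
Variable T : finType.

Definition preds (G : rel T) (B : {set T}) : {set T} :=
  B :|: [set u | [exists v in B, G u v]].

(** Time runs from [t] to [t + s]: [B] sits at the end, the result at the start, and [G r] links
    time [r] to [r + 1]. *)
Fixpoint ancestors (G : nat -> rel T) (t s : nat) (B : {set T}) : {set T} :=
  if s is s'.+1 then preds (G t) (ancestors G t.+1 s' B) else B.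

Lemma predsP (G : rel T) (B : {set T}) u :
  reflect (exists2 v, v \in B & (u == v) || G u v) (u \in preds G B).
Proof.
rewrite !inE; apply: (iffP orP) => [[uB|/existsP[v /andP[vB Guv]]]|[v vB]].
- by exists u; rewrite ?eqxx.
- by exists v; rewrite ?Guv ?orbT.
- case/orP=> [/eqP->|Guv]; first by left.
  by right; apply/existsP; exists v; rewrite vB.
Qed.

Lemma sub_preds G (B : {set T}) : B \subset preds G B.
Proof. exact: finset.subsetUl. Qed.

Lemma preds_closed G (B : {set T}) u v :
  preds G B \subset B -> v \in B -> G u v -> u \in B.
Proof.
move=> /fintype.subsetP sB vB Guv; apply: sB; apply/predsP.
by exists v; rewrite // Guv orbT.
Qed.

Variables (G : nat -> rel T) (N : {set T}).
Hypothesis GN : forall t u v, G t u v -> u \in N.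

Lemma ancestors_sub t s (B : {set T}) :
  B \subset N -> ancestors G t s B \subset N.
Proof.
move=> BN; elim: s t => //= s IHs t; apply/fintype.subsetP => u /predsP[v vB].
case/orP=> [/eqP->|]; last exact: GN.
exact: (fintype.subsetP (IHs _)) vB.
Qed.

Lemma ancestors_neq0 t s (B : {set T}) : B != finset.set0 -> ancestors G t s B != finset.set0.
Proof.
move=> B0; elim: s t => //= s IHs t.
by apply: contraNneq (IHs t.+1) => e0; rewrite -finset.subset0 -e0 sub_preds.
Qed.

(** Going back in time, the ancestor set gains a node at each step until it is closed. It then meets
    [P], and still does later because [preds] only enlarges. Growth cannot last for [#|T|] steps. *)
Lemma ancestors_meet (P B : {set T}) t s :
    B != finset.set0 -> B \subset N -> (#|T| <= s)%N ->
    (forall r (C : {set T}), (t <= r)%N -> (r < t + s)%N ->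
      C != finset.set0 -> C \subset N -> preds (G r) C \subset C -> C :&: P != finset.set0) ->
  exists2 u, u \in P & u \in ancestors G t s B.
Proof.
move=> B0 BN Ts meet.
suff: (ancestors G t s B :&: P != finset.set0) || (s < #|ancestors G t s B|)%N.
  case/orP=> [/finset.set0Pn[u /finset.setIP[uB uP]]|]; first by exists u.
  by move=> /leq_trans/(_ (max_card _)); rewrite ltnNge Ts.
elim: s t meet {Ts} => [|s IHs] t meet /=; first by rewrite card_gt0 B0 orbT.
set C := ancestors G t.+1 s B.
have /orP[/finset.set0Pn[u /finset.setIP[uC uP]]|lt_s] : (C :&: P != finset.set0) || (s < #|C|)%N.
- apply: IHs => // r D tr rs; apply: meet; lia.
- apply/orP; left; apply/finset.set0Pn; exists u; rewrite inE uP andbT.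
  exact: (fintype.subsetP (sub_preds _ _)) uC.
have [sub|nsub] := boolP (preds (G t) C \subset C).
  have : C :&: P != finset.set0.
    apply: (meet t) sub => //; first lia.
    - exact: ancestors_neq0.
    - exact: ancestors_sub.
  case/finset.set0Pn=> u /finset.setIP[uC uP]; apply/orP; left; apply/finset.set0Pn; exists u.
  by rewrite inE uP andbT; exact: (fintype.subsetP (sub_preds _ _)) uC.
apply/orP; right; apply: leq_ltn_trans lt_s _; apply: proper_card.
by rewrite fintype.properE sub_preds.
Qed.

(* As long as the two ancestor sets are disjoint, they cannot both be closed, so their total size grows at every step. *)
Lemma ancestors_meet2 (B B' : {set T}) t s :
    B != finset.set0 -> B' != finset.set0 -> B \subset N -> B' \subset N ->
    (#|T| + #|T| <= s)%N ->
    (forall r (C C' : {set T}), (t <= r)%N -> (r < t + s)%N ->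
      C != finset.set0 -> C' != finset.set0 -> C \subset N -> C' \subset N ->
      preds (G r) C \subset C -> preds (G r) C' \subset C' ->
      C :&: C' != finset.set0) ->
  exists2 u, u \in ancestors G t s B & u \in ancestors G t s B'.
Proof.
move=> B0 B0' BN BN' Ts meet.
suff: (ancestors G t s B :&: ancestors G t s B' != finset.set0) ||
      (s < #|ancestors G t s B| + #|ancestors G t s B'|)%N.
  case/orP=> [/finset.set0Pn[u /finset.setIP[uB uB']]|]; first by exists u.
  move=> lt_s; have : (s < #|T| + #|T|)%N.
    by apply: leq_trans lt_s _; apply: leq_add; exact: max_card.
  by rewrite ltnNge Ts.
elim: s t meet {Ts} => [|s IHs] t meet /=.
  by rewrite [X in _ || X]ltn_addr ?orbT // card_gt0.
set C := ancestors G t.+1 s B; set C' := ancestors G t.+1 s B'.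
have CI : C :&: C' != finset.set0 -> preds (G t) C :&: preds (G t) C' != finset.set0.
  case/finset.set0Pn=> u /finset.setIP[uC uC']; apply/finset.set0Pn; exists u.
  by rewrite inE !(fintype.subsetP (sub_preds _ _)).
have /orP[/CI->//|lt_s] : (C :&: C' != finset.set0) || (s < #|C| + #|C'|)%N.
  apply: IHs => // r D D' tr rs; apply: meet; lia.
have leC := subset_leq_card (sub_preds (G t) C).
have leC' := subset_leq_card (sub_preds (G t) C').
have [sub|nsub] := boolP (preds (G t) C \subset C); last first.
  have : (#|C| < #|preds (G t) C|)%N.
    by apply: proper_card; rewrite fintype.properE sub_preds.
  lia.
have [sub'|nsub'] := boolP (preds (G t) C' \subset C'); last first.
  have : (#|C'| < #|preds (G t) C'|)%N.
    by apply: proper_card; rewrite fintype.properE sub_preds.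
  lia.
rewrite CI //; apply: (meet t) sub sub' => //; first lia.
- exact: ancestors_neq0.
- exact: ancestors_neq0.
- exact: ancestors_sub.
- exact: ancestors_sub.
Qed.

(** Each link of a chain from [u] to [B] scales the gap by [b] and costs [e]; as [b <= 1], the costs
    add up to at most [s * e]. *)
Lemma ancestors_gap (R : realType) (gap : nat -> T -> R) (b e : R)
    (B : {set T}) t s u :
    0 <= b <= 1 -> 0 <= e -> B \subset N ->
    (forall r i j, (t <= r)%N -> (r < t + s)%N -> j \in N ->
      (i == j) || G r i j -> b * gap r i - e <= gap r.+1 j) ->
    u \in ancestors G t s B ->
  exists2 v, v \in B & b ^+ s * gap t u - s%:R * e <= gap (t + s)%N v.
Proof.
move=> /andP[b0 b1] e0 BN; elim: s t u => [|s IHs] t u step /=.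
  by move=> uB; exists u; rewrite // addn0 expr0 mul1r mul0r subr0.
case/predsP=> w wA uw.
have [|v vB le_v] := IHs _ _ _ wA.
  by move=> r i j tr rs; apply: step; lia.
exists v => //; rewrite addnS -addSn; apply: le_trans le_v.
have wN : w \in N by exact: (fintype.subsetP (ancestors_sub _ _ BN)) wA.
have := step t u w (leqnn _) _ wN uw; rewrite -addSnnS leq_addr => /(_ isT) le_w.
have bs0 : 0 <= b ^+ s by exact: exprn_ge0.
have bs1 : b ^+ s <= 1 by exact: exprn_ile1.
have := ler_wpM2l bs0 le_w; rewrite -natr1 exprSr mulrDl mul1r.
have : b ^+ s * e <= e by rewrite ler_piMl.
rewrite mulrBr mulrA; lra.
Qed.

End Ancestors.

(** * Source components and the sparsity parameter *)

(** A path from a source node to a node of [B] is walked backwards, and closure keeps it inside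
    [B]. *)
Lemma source_component_sub (n : nat) (F : {set 'I_n}) (E' : rel 'I_n)
    (B : {set 'I_n}) :
    B != finset.set0 -> B \subset ~: F ->
    (forall u v, v \in B -> E' u v -> u \in B) ->
  source_component F E' \subset B.
Proof.
move=> /finset.set0Pn[w wB] /fintype.subsetP BF closed; apply/fintype.subsetP => u; rewrite inE => /andP[_].
have := BF w wB; rewrite inE => wF /forallP/(_ w); rewrite wF => /connectP[p].
elim: p u => [|v p IHp] u /=; first by move=> _ <-.
by case/andP=> /and3P[Euv _ _] pth lst; exact: closed (IHp _ pth lst) Euv.
Qed.

Lemma sp_meet (R : realType) (k n : nat) (A : 'M[R]_(k, n)) (B : {set 'I_n}) j :
  (sp A <= #|B|)%N -> exists2 i, i \in B & 0 < A j i.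
Proof.
move=> spB.
have spn : (sp A <= n)%N by rewrite (leq_trans spB) // -[X in (_ <= X)%N]card_ord max_card.
(* The minimum defining [sp A] is attained unless it is the default [n.+1], which [spn] excludes. *)
have spA : sp_ok A (sp A).
  have: sp A = n.+1 \/ sp_ok A (sp A).
    rewrite /sp; elim/big_ind: _ => [|s r hs hr|s ?]; [by left| |by right].
    by rewrite /minn; case: ifP.
  by case=> // e; move: spn; rewrite e ltnn.
have [S] : exists S : {set 'I_n}, S \in [set S : {set 'I_n} | S \subset B & #|S| == sp A].
  by apply/finset.set0Pn; rewrite -card_gt0 cards_draws bin_gt0.
rewrite inE => /andP[SB cS].
have := forallP spA S; rewrite cS => /forallP/(_ j) pos.
have [/existsP[i /andP[iS Ai]]|] := boolP [exists i in S, 0 < A j i].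
  by exists i; rewrite ?(fintype.subsetP SB).
rewrite negb_exists => /forallP nonpos; move: pos.
rewrite ltNge sumr_le0 // => i iS; have := nonpos i; rewrite iS /=.
by rewrite -leNgt.
Qed.

(** * Trimmed averages *)

Section Pulls.
Variables (R : realType) (n : nat).
Implicit Types (b lo hi : R) (F : {set 'I_n}) (y v : 'I_n -> R).

(* The value v is at least the fraction b of the way from either end of [lo, hi] towards a, as is an average of points of [lo, hi] giving a weight at least b. *)
Definition pulls b lo hi (a v : R) : bool :=
  (lo + b * (a - lo) <= v) && (v <= hi - b * (hi - a)).

Definition pull_rel b lo hi (E : rel 'I_n) F y v : rel 'I_n :=
  fun i j => [&& E i j, i \notin F, j \notin F & pulls b lo hi (y i) (v j)].

Definition between lo hi F y : Prop :=
  forall i, i \notin F -> lo <= y i <= hi.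

Lemma pullsN b lo hi (a v : R) : pulls b (- hi) (- lo) (- a) (- v) = pulls b lo hi a v.
Proof.
rewrite /pulls andbC; congr (_ && _).
  by apply/idP/idP => ?; lra.
by apply/idP/idP => ?; lra.
Qed.

Lemma pull_relN b lo hi E F y v :
  pull_rel b (- hi) (- lo) E F (fun i => - y i) (fun i => - v i) =
  pull_rel b lo hi E F y v.
Proof. by apply/funext => i; apply/funext => j; rewrite /pull_rel pullsN. Qed.

Lemma betweenN lo hi F y :
  between (- hi) (- lo) F (fun i => - y i) -> between lo hi F y.
Proof. by move=> bt i /bt; lra. Qed.

(** [s * (hi - v)] is the sum of the nonnegative distances from [hi] to the averaged values, so it
    dominates each of them; likewise for [lo]. The common weight [s^-1] is at least [b] because
    [s <= n + 1]. *)
Lemma pulls_average b lo hi (S : {set 'I_n}) (w : 'I_n -> R) (a : R) :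
    0 <= b -> b * (n%:R + 1) <= 1 ->
    lo <= a <= hi -> (forall j, j \in S -> lo <= w j <= hi) ->
  let v := (#|S|%:R + 1)^-1 * (a + \sum_(j in S) w j) in
  pulls b lo hi a v /\ forall j, j \in S -> pulls b lo hi (w j) v.
Proof.
move=> b0 bn /andP[la ah] bw /=.
set s : R := #|S|%:R + 1; set v := _ * _.
have s0 : 0 < s by rewrite /s ltr_wpDl.
have bs : b <= s^-1.
  rewrite -div1r ler_pdivlMr //; apply: le_trans bn; apply: ler_wpM2l => //.
  by rewrite lerD2r ler_nat -[X in (_ <= X)%N]card_ord max_card.
have vE : s * v = a + \sum_(j in S) w j by rewrite /v mulrA mulfV ?mul1r ?gt_eqF.
have up : \sum_(j in S) (hi - w j) = #|S|%:R * hi - \sum_(j in S) w j.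
  by rewrite big_split sumrN /= sumr_const mulr_natl.
have dn : \sum_(j in S) (w j - lo) = \sum_(j in S) w j - #|S|%:R * lo.
  by rewrite big_split sumrN /= sumr_const mulr_natl.
have key c : lo <= c <= hi -> hi - c <= s * (hi - v) -> c - lo <= s * (v - lo) ->
    pulls b lo hi c v.
  move=> /andP[lc ch] h1 h2; apply/andP; split.
    have : b * (c - lo) <= s^-1 * (c - lo) by apply: ler_wpM2r => //; lra.
    have : s^-1 * (c - lo) <= v - lo by rewrite ler_pdivrMl.
    lra.
  have : b * (hi - c) <= s^-1 * (hi - c) by apply: ler_wpM2r => //; lra.
  have : s^-1 * (hi - c) <= hi - v by rewrite ler_pdivrMl.
  lra.
have hi_s : s * (hi - v) = (hi - a) + \sum_(j in S) (hi - w j).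
  by rewrite mulrBr vE up /s; ring.
have lo_s : s * (v - lo) = (a - lo) + \sum_(j in S) (w j - lo).
  by rewrite mulrBr vE dn /s; ring.
split.
  apply: key; rewrite ?la ?hi_s ?lo_s ?lerDl //; apply: sumr_ge0 => j /bw; lra.
move=> j jS; apply: key; first exact: bw.
  rewrite hi_s (bigD1 j) //= addrCA lerDl addr_ge0 //; first lra.
  by apply: sumr_ge0 => i /andP[/bw]; lra.
rewrite lo_s (bigD1 j) //= addrCA lerDl addr_ge0 //; first lra.
by apply: sumr_ge0 => i /andP[/bw]; lra.
Qed.

(** A value kept from a faulty sender [j] lies between those of a non-faulty member of [Lo] and one
    of [Hi]. Both exist: [f] faulty nodes would make up all of [F], but [j] is in neither set. *)
Lemma trimmed_between f lo hi F (Nin S : {set 'I_n}) y w :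
    (#|F| <= f)%N -> between lo hi F y -> (forall j, j \notin F -> w j = y j) ->
    trimmed f Nin w S ->
  forall j, j \in S -> lo <= w j <= hi.
Proof.
move=> Ff bt wy [Lo [Hi [[_ _ _] [[cLo cHi SE] [LoS SHi _]]]]] j jS.
have [jF|jF] := boolP (j \in F); last by rewrite wy ?bt.
have good (X : {set 'I_n}) : #|X| = f -> j \notin X -> exists2 l, l \in X & l \notin F.
  move=> cX jX; apply/fintype.subsetPn/negP => XF.
  have /eqP XE : X == F by rewrite eqEcard XF cX.
  by rewrite XE jF in jX.
have [jLo jHi] : j \notin Lo /\ j \notin Hi.
  by move: jS; rewrite SE !inE negb_or => /andP[/andP[]].
have [l lLo lF] := good _ cLo jLo; have [m mHi mF] := good _ cHi jHi.
have := LoS _ _ lLo jS; have := SHi _ _ jS mHi.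
by rewrite (wy _ lF) (wy _ mF); have := bt _ lF; have := bt _ mF; lra.
Qed.

(* A kept value separates the discarded low values from the discarded high ones. If it lies in the upper half of [lo, hi], then it pulls the average at least as strongly as half of any discarded high value would, and symmetrically: only one of the two discarded sets, of size f, fails to pull. *)
Lemma trimmed_pulls b f lo hi F (Nin S : {set 'I_n}) y w i :
    0 <= b -> b *+ 2 * (n%:R + 1) <= 1 ->
    (#|F| <= f)%N -> between lo hi F y -> (forall j, j \notin F -> w j = y j) ->
    trimmed f Nin w S -> (S = finset.set0 -> f = 0%N) -> i \notin F ->
  let v := (#|S|%:R + 1)^-1 * (y i + \sum_(j in S) w j) in
  pulls b lo hi (y i) v /\
  (#|[set u | [&& u \in Nin, u \notin F & ~~ pulls b lo hi (y u) v]]| <= f)%N.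
Proof.
move=> b0 bn Ff bt wy tr S0 iF v.
have Sbt := trimmed_between Ff bt wy tr.
have b20 : 0 <= b *+ 2 by rewrite mulrn_wge0.
have [pi pS] := pulls_average b20 bn (bt _ iF) Sbt.
have weaken c : lo <= c <= hi -> pulls (b *+ 2) lo hi c v -> pulls b lo hi c v.
  move=> /andP[lc ch] /andP[]; rewrite !mulrnAl /pulls.
  have : 0 <= b * (c - lo) by rewrite mulr_ge0 // subr_ge0.
  have : 0 <= b * (hi - c) by rewrite mulr_ge0 // subr_ge0.
  by move=> *; apply/andP; split; lra.
split; first exact: weaken (bt _ iF) pi.
case: tr => Lo [Hi [[LoN HiN _] [[cLo cHi SE] [LoS SHi _]]]].
have split_in u : u \in Nin -> [|| u \in S, u \in Lo | u \in Hi].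
  by move=> uN; rewrite SE !inE uN andbT; case: (u \in Lo); case: (u \in Hi).
have sub (X : {set 'I_n}) : #|X| = f ->
    (forall u, u \in Nin -> u \notin F -> u \notin S -> u \notin X -> pulls b lo hi (y u) v) ->
    (#|[set u | [&& u \in Nin, u \notin F & ~~ pulls b lo hi (y u) v]]| <= f)%N.
  move=> <- good; apply: subset_leq_card; apply/fintype.subsetP => u.
  rewrite inE => /and3P[uN uF]; apply: contraNT => uX.
  have [uS|uS] := boolP (u \in S); last exact: good.
  by apply: weaken (bt _ uF) _; rewrite -wy // pS.
(* With nothing kept, [f] is 0, so nothing was discarded either and there is no in-neighbour. *)
have [/S0 f0|/finset.set0Pn[m mS]] := eqVneq S finset.set0.
  apply: (sub Lo cLo) => u uN uF uS uL; have := split_in _ uN.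
  rewrite (negPf uS) (negPf uL) /=.
  by move: cHi; rewrite f0 => /eqP; rewrite cards_eq0 => /eqP ->; rewrite inE.
have mbt := Sbt _ mS; have : pulls (b *+ 2) lo hi (w m) v by exact: pS.
rewrite /pulls !mulrnAl => /andP[v1 v2].
have [mid|mid] := leP (hi - w m) (w m - lo).
  apply: (sub Lo cLo) => u uN uF uS uL; have := split_in _ uN.
  rewrite (negPf uS) (negPf uL) /= => uH.
  have := SHi _ _ mS uH; rewrite (wy u) // => mu; have ubt := bt _ uF.
  have : b * (y u - lo) <= b * (w m - lo) *+ 2.
    by rewrite -mulrnAr; apply: ler_wpM2l => //; lra.
  have : b * (hi - y u) <= b * (hi - w m) by apply: ler_wpM2l => //; lra.
  have : 0 <= b * (hi - w m) by apply: mulr_ge0 => //; lra.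
  by move=> *; apply/andP; split; lra.
apply: (sub Hi cHi) => u uN uF uS uH; have := split_in _ uN.
rewrite (negPf uS) (negPf uH) orbF /= => uL.
have := LoS _ _ uL mS; rewrite (wy u) // => mu; have ubt := bt _ uF.
have : b * (hi - y u) <= b * (hi - w m) *+ 2.
  by rewrite -mulrnAr; apply: ler_wpM2l => //; lra.
have : b * (y u - lo) <= b * (w m - lo) by apply: ler_wpM2l => //; lra.
have : 0 <= b * (w m - lo) by apply: mulr_ge0 => //; lra.
by move=> *; apply/andP; split; lra.
Qed.

End Pulls.

(** If the in-degree were at most [2f], up to [f] in-neighbours could be taken as [F'] and the edges
    from the others deleted. Then [i] has no incoming edge, so the source component is at most
    [{i}], short of the [f + 1 >= 2] nodes of Condition 1. *)
Lemma condition1_in_nbrs (R : realType) (n k f : nat) (E : rel 'I_n)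
    (A : 'M[R]_(k, n)) (i : 'I_n) :
  no_self_loops E -> condition1 f E A -> (0 < f)%N -> (f.*2 < #|in_nbrs E i|)%N.
Proof.
move=> nsl c1 f0; rewrite ltnNge; apply/negP => le2f.
set N := in_nbrs E i in le2f *.
have [F' [F'N F'f NF'f]] : exists F' : {set 'I_n},
    [/\ F' \subset N, (#|F'| <= f)%N & (#|N :\: F'| <= f)%N].
  have : (0 < #|[set S : {set 'I_n} | S \subset N & #|S| == minn f #|N|]|)%N.
    by rewrite cards_draws bin_gt0 geq_minr.
  rewrite card_gt0 => /finset.set0Pn[S]; rewrite inE => /andP[SN /eqP cS].
  exists S; split => //; first by rewrite cS geq_minl.
  by rewrite cardsDS // cS; move: le2f; rewrite -addnn; lia.
have iF' : i \notin F'.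
  apply/negP => /(fintype.subsetP F'N); rewrite inE; exact/negP/nsl.
pose E' : rel 'I_n := fun u v => [&& E u v, u \notin F', v \notin F' & v != i].
have red : reduced_graph f E F' E'.
  split=> [u v /and4P[]//|v vF'].
  have [->|vi] := eqVneq v i.
    apply: leq_trans NF'f; apply: subset_leq_card; apply/fintype.subsetP => u.
    by rewrite !inE => /and3P[-> -> _].
  rewrite eq_card0 // => u.
  by rewrite !inE /E' vF' vi /= andbT; case: (E u v); case: (u \in F').
have := c1 _ F'f _ red; rewrite geq_max => /andP[lt_f _].
have sub : source_component F' E' \subset [set i]%SET.
  apply: source_component_sub; first by apply/finset.set0Pn; exists i; rewrite inE.
    by apply/fintype.subsetP => u; rewrite !inE => /eqP ->.
  by move=> u v; rewrite !inE => /eqP -> /and4P[_ _ _]; rewrite eqxx.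
have := subset_leq_card sub; rewrite cards1; lia.
Qed.

(** * Consensus *)

Section Dynamics.
Variables (R : realType) (n f : nat) (E : rel 'I_n) (F : {set 'I_n}).
Variables (b L : R) (alpha : nat -> R).
Hypotheses (b_gt0 : 0 < b) (b_le1 : b <= 1) (L_ge0 : 0 <= L).
Hypotheses (alpha_ge0 : forall t, 0 <= alpha t).
Hypotheses (alpha_dec : forall s t, (s <= t)%N -> alpha t <= alpha s).
Hypothesis alpha_small :
  forall e : R, 0 < e -> exists N, forall t, (N <= t)%N -> alpha t < e.
Hypothesis has_source :
  forall E', reduced_graph f E F E' -> source_component F E' != finset.set0.

(* x t.+1 j + alpha t * d t j is the state before the subgradient step; z stands for a minimizer common to all the costs. *)
Definition dynamics (z : R) (x d : nat -> 'I_n -> R) : Prop :=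
  [/\ forall t lo hi, between lo hi F (x t) ->
        let v j := x t.+1 j + alpha t * d t j in
        reduced_graph f E F (pull_rel b lo hi E F (x t) v) /\
        forall j, j \notin F -> pulls b lo hi (x t j) (v j),
      forall t i, i \notin F -> `|d t i| <= L &
      forall t i, i \notin F -> d t i * (z - x t i) <= 0].

(** Reflection turns every upper bound on the states into a lower bound. *)
Lemma dynamicsN z x d : dynamics z x d ->
  dynamics (- z) (fun t i => - x t i) (fun t i => - d t i).
Proof.
case=> mix dL dz; split=> [t lo hi bt /=|t i iF|t i iF]; last 2 first.
- by rewrite normrN dL.
- have := dz t i iF; nra.
have vN : (fun j => - x t.+1 j + alpha t * - d t j) =
          (fun j => - (x t.+1 j + alpha t * d t j)).
  by apply/funext => j; rewrite mulrN opprD.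
have [] := mix t (- hi) (- lo).
  by apply: betweenN => i iF; rewrite !opprK; exact: bt.
have := pull_relN b (- hi) (- lo) E F (x t) (fun j => x t.+1 j + alpha t * d t j).
rewrite vN !opprK => -> red self; split => // j jF.
have -> : - x t.+1 j + alpha t * - d t j = - (x t.+1 j + alpha t * d t j).
  by rewrite mulrN opprD.
by rewrite -[lo]opprK -[hi]opprK pullsN self.
Qed.

Lemma lower_bound (y : 'I_n -> R) : exists lo, forall i, lo <= y i.
Proof.
exists (- \sum_i `|y i|) => i; rewrite lerNl (le_trans (ler_norm _)) // normrN.
by rewrite (bigD1 i) //= lerDl sumr_ge0.
Qed.

Lemma step_between z x d t lo hi : dynamics z x d -> between lo hi F (x t) ->
  between (lo - alpha t * L) (hi + alpha t * L) F (x t.+1).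
Proof.
have b0 := b_gt0; move=> [mix dL _] bt i iF; have [_ /(_ i iF)/andP[v1 v2]] := mix _ _ _ bt.
have := bt i iF => /andP[x1 x2].
have : 0 <= b * (x t i - lo) by apply: mulr_ge0; lra.
have : 0 <= b * (hi - x t i) by apply: mulr_ge0; lra.
have : `|alpha t * d t i| <= alpha t * L.
  by rewrite normrM ger0_norm // ler_wpM2l // dL.
by rewrite ler_norml => /andP[]; lra.
Qed.

Lemma steps_between z x d t lo hi s : dynamics z x d -> between lo hi F (x t) ->
  between (lo - s%:R * (alpha t * L)) (hi + s%:R * (alpha t * L)) F (x (t + s)%N).
Proof.
move=> dyn bt; elim: s => [|s IHs] i iF.
  by rewrite mul0r subr0 addr0 addn0 bt.
have := step_between dyn IHs iF; rewrite -natr1 mulrDl mul1r addnS.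
have : alpha (t + s)%N * L <= alpha t * L.
  by apply: ler_wpM2r => //; apply: alpha_dec; exact: leq_addr.
lra.
Qed.

(** Above [z] the step does not go up. At or below [z] the distance to [B] is at least
    [L / b * alpha t], and averaging keeps a fraction [b] of it: enough room for a step of length at
    most [L * alpha t]. *)
Lemma step_le z x d t B : dynamics z x d -> z + L / b * alpha t <= B ->
  (forall i, i \notin F -> x t i <= B) ->
  forall i, i \notin F -> x t.+1 i <= B.
Proof.
have b0 := b_gt0; move=> [mix dL dz] zB xB i iF.
have [lo lo_le] := lower_bound (x t).
have bt : between lo B F (x t) by move=> j jF; rewrite lo_le xB.
have [_ /(_ i iF)/andP[_ v2]] := mix _ _ _ bt.
have a0 := alpha_ge0 t.
have [zx|xz] := ltP z (x t i).
  have : 0 <= d t i by have := dz t i iF; nra.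
  move=> /(mulr_ge0 a0).
  have : 0 <= b * (B - x t i) by apply: mulr_ge0; [lra|have := xB i iF; lra].
  lra.
have : alpha t * L <= b * (B - x t i).
  have -> : alpha t * L = b * (L / b * alpha t) by field; lra.
  by apply: ler_wpM2l; lra.
have : `|alpha t * d t i| <= alpha t * L.
  by rewrite normrM ger0_norm // ler_wpM2l // dL.
by rewrite ler_norml => /andP[]; lra.
Qed.

Lemma stay_le z x d t B : dynamics z x d -> z + L / b * alpha t <= B ->
  (forall i, i \notin F -> x t i <= B) ->
  forall s i, (t <= s)%N -> i \notin F -> x s i <= B.
Proof.
move=> dyn zB xB s i /subnKC <-; elim: (s - t)%N i => [|r IHr] i.
  by rewrite addn0; exact: xB.
rewrite addnS; apply: (step_le dyn) => //; apply: le_trans zB.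
rewrite lerD2l; apply: ler_wpM2l; first exact: divr_ge0 (ltW _).
by apply: alpha_dec; exact: leq_addr.
Qed.

Definition osc (y : 'I_n -> R) D : Prop :=
  forall i j, i \notin F -> j \notin F -> y i - y j <= D.

Lemma osc_le y D D' : D <= D' -> osc y D -> osc y D'.
Proof. by move=> le_D o i j iF jF; exact: le_trans (o i j iF jF) le_D. Qed.

Lemma bounded_above z x d : dynamics z x d ->
  exists B, forall t i, i \notin F -> x t i <= B.
Proof.
move=> dyn; have [lo lo_le] := lower_bound (fun i => - x 0%N i).
exists (Num.max (- lo) (z + L / b * alpha 0)) => t i iF.
apply: (stay_le (t := 0%N) dyn) => //; first by rewrite le_max lexx orbT.
by move=> j _; rewrite le_max; have := lo_le j; rewrite lerNr => ->.
Qed.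

Lemma osc_bounded z x d : dynamics z x d -> exists2 D : R, 0 <= D & forall t, osc (x t) D.
Proof.
move=> dyn; have [B xB] := bounded_above dyn.
have [C xC] := bounded_above (dynamicsN dyn).
exists `|B + C| => // t i j iF jF; apply: le_trans (ler_norm _).
by have := xB t i iF; have := xC t j jF; lra.
Qed.

Lemma pull_relF lo hi y v i j : pull_rel b lo hi E F y v i j -> i \in ~: F.
Proof. by rewrite inE => /and4P[]. Qed.

Definition window_rel lo hi (x d : nat -> 'I_n -> R) (r : nat) : rel 'I_n :=
  pull_rel b lo hi E F (x r) (fun j => x r.+1 j + alpha r * d r j).

Lemma closed_source x d r lo hi (C : {set 'I_n}) :
    C != finset.set0 -> C \subset ~: F ->
    preds (window_rel lo hi x d r) C \subset C ->
  source_component F (window_rel lo hi x d r) \subset C.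
Proof.
move=> C0 CF closed; apply: source_component_sub => // u v.
exact: preds_closed closed.
Qed.

Lemma window_pulls z x d r lo hi i j :
    dynamics z x d -> between lo hi F (x r) -> j \notin F ->
    (i == j) || window_rel lo hi x d r i j ->
  pulls b lo hi (x r i) (x r.+1 j + alpha r * d r j).
Proof.
move=> [mix _ _] bt jF /orP[/eqP->|/and4P[//]].
by have [_] := mix _ _ _ bt; apply.
Qed.

(** The distances of a common ancestor to [hi] and to [lo] add up to [hi - lo]; the first survives
    at [i], the second at [j], each scaled by [b ^+ w] up to an error [w * e]. *)
Lemma osc_contract z x d t D : dynamics z x d -> osc (x t) D -> 0 <= D ->
  osc (x (t + (n + n))%N)
    ((1 - b ^+ (n + n)) * D + 4 * (n + n)%:R * L * alpha t).
Proof.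
move=> dyn oD D0 i j iF jF; set w := (n + n)%N; set e := alpha t * L.
have e0 : 0 <= e by exact: mulr_ge0.
have [m [M [bt MmD]]] : exists m M, between m M F (x t) /\ M - m <= D.
  case: (@Order.TotalTheory.arg_maxP _ _ _ i [pred k | k \notin F] (x t) iF) => /= k kF kmax.
  case: (@Order.TotalTheory.arg_minP _ _ _ i [pred k | k \notin F] (x t) iF) => /= l lF lmin.
  exists (x t l), (x t k); split; last exact: oD.
  by move=> u uF; rewrite lmin // kmax.
(* The range at time [t] is widened to hold all states of the window, which costs [2 * w * e]; the
   errors of the two gaps cost as much again, whence the factor 4. *)
set lo := m - w%:R * e; set hi := M + w%:R * e.
have win r : (t <= r)%N -> (r < t + w)%N -> between lo hi F (x r).
  move=> /subnKC <-; rewrite ltn_add2l => /ltnW sw u uF.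
  have := steps_between (r - t)%N dyn bt uF; rewrite /lo /hi -/e.
  have : (r - t)%:R * e <= w%:R * e by rewrite ler_wpM2r // ler_nat.
  lra.
pose G := window_rel lo hi x d.
have GF r u v : G r u v -> u \in ~: F by exact: pull_relF.
have [u uj ui] : exists2 u, u \in ancestors G t w [set j]%SET &
                          u \in ancestors G t w [set i]%SET.
  apply: (ancestors_meet2 GF); rewrite ?card_ord //.
  - by apply/finset.set0Pn; exists j; rewrite inE.
  - by apply/finset.set0Pn; exists i; rewrite inE.
  - by rewrite finset.sub1set inE.
  - by rewrite finset.sub1set inE.
  move=> r C C' tr rt C0 C0' CF CF' cl cl'.
  have btr := win r tr rt.
  have [mix _ _] := dyn; have [/has_source/finset.set0Pn[s ss] _] := mix _ _ _ btr.
  apply/finset.set0Pn; exists s; rewrite inE.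
  by rewrite !(fintype.subsetP (closed_source _ _ _) s ss).
have stepe r k : (t <= r)%N -> k \notin F -> `|alpha r * d r k| <= e.
  move=> tr kF; rewrite normrM ger0_norm //; apply: ler_pM => //.
    exact: alpha_dec.
  by have [_ dL _] := dyn; exact: dL.
have b01 : 0 <= b <= 1 by rewrite ltW.
have iN : [set i]%SET \subset ~: F by rewrite finset.sub1set inE.
have jN : [set j]%SET \subset ~: F by rewrite finset.sub1set inE.
have up r k l : (t <= r)%N -> (r < t + w)%N -> l \in ~: F ->
    (k == l) || G r k l -> b * (hi - x r k) - e <= hi - x r.+1 l.
  move=> tr rt; rewrite inE => lF kl.
  have /andP[_] := window_pulls dyn (win r tr rt) lF kl.
  by have := stepe r l tr lF; rewrite ler_norml => /andP[]; lra.
have down r k l : (t <= r)%N -> (r < t + w)%N -> l \in ~: F ->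
    (k == l) || G r k l -> b * (x r k - lo) - e <= x r.+1 l - lo.
  move=> tr rt; rewrite inE => lF kl.
  have /andP[+ _] := window_pulls dyn (win r tr rt) lF kl.
  by have := stepe r l tr lF; rewrite ler_norml => /andP[]; lra.
have [v] := ancestors_gap (gap := fun r k => hi - x r k) GF b01 e0 iN up ui.
rewrite inE => /eqP -> gi.
have [v'] := ancestors_gap (gap := fun r k => x r k - lo) GF b01 e0 jN down uj.
rewrite inE => /eqP -> gj.
have -> : 4 * w%:R * L * alpha t = 4 * (w%:R * e) by rewrite /e; ring.
have q0 : 0 <= b ^+ w by rewrite exprn_ge0 // ltW.
have q1 : b ^+ w <= 1 by rewrite exprn_ile1 // ltW.
have : (1 - b ^+ w) * (hi - lo) <= (1 - b ^+ w) * (D + 2 * (w%:R * e)).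
  by apply: ler_wpM2l; rewrite ?subr_ge0 // /hi /lo; lra.
have : 0 <= b ^+ w * (w%:R * e) by rewrite !mulr_ge0.
by move: gi gj; rewrite -/w; lra.
Qed.

Lemma osc_small z x d : dynamics z x d ->
  forall e : R, 0 < e -> exists N, forall t, (N <= t)%N -> osc (x t) e.
Proof.
move=> dyn e e0; have [D D0 oD] := osc_bounded dyn.
set w := (n + n)%N; set q := b ^+ w; set K := 4 * w%:R * L.
have q0 : 0 < q by exact: exprn_gt0.
have q1 : q <= 1 by rewrite exprn_ile1 // ltW.
have K0 : 0 <= K by rewrite /K !mulr_ge0.
have iter k : exists N, forall t, (N <= t)%N ->
    osc (x t) ((1 - q) ^+ k * D + e / 2).
  elim: k => [|k [N oN]].
    exists 0%N => t _; apply: osc_le (oD t); rewrite expr0 mul1r; lra.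
  (* Once [K * alpha <= q * e / 2], the summand [e / 2] reproduces itself under contraction. [K] may
     be 0, hence [K + 1]. *)
  have [N' aN'] := alpha_small (e := q * e / 2 / (K + 1)) ltac:(apply: divr_gt0; nra).
  exists (maxn N N' + w)%N => t tN.
  have wt : (w <= t)%N by apply: leq_trans tN; exact: leq_addl.
  have {}tN : (maxn N N' <= t - w)%N by rewrite leq_subRL // addnC.
  have : osc (x (t - w + w)%N) ((1 - q) * ((1 - q) ^+ k * D + e / 2) + K * alpha (t - w)%N).
    apply: (osc_contract dyn); first by apply: oN; move: tN; rewrite geq_max => /andP[].
    rewrite addr_ge0 //; last by lra.
    by rewrite mulr_ge0 // exprn_ge0 // subr_ge0.
  rewrite subnK //; apply: osc_le; rewrite exprS.
  have aK : alpha (t - w)%N < q * e / 2 / (K + 1).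
    by apply: aN'; move: tN; rewrite geq_max => /andP[].
  have : K * alpha (t - w)%N <= q * e / 2.
    apply: (@le_trans _ _ ((K + 1) * alpha (t - w)%N)).
      by apply: ler_wpM2r => //; lra.
    by rewrite mulrC -ler_pdivlMr; [exact: ltW | lra].
  lra.
have [k qk] : exists k, (1 - q) ^+ k * D <= e / 2.
  have cv : (fun k => (1 - q) ^+ k : R) @ \oo --> (0 : R).
    by apply: cvg_expr; rewrite ger0_norm; lra.
  have e2 : 0 < e / 2 / (D + 1) by apply: divr_gt0; lra.
  have /cvgr0Pnorm_le/(_ _ e2)[k _ /(_ k (leqnn k))] := cv.
  rewrite /= ger0_norm; last by rewrite exprn_ge0 // subr_ge0.
  move=> le_k; exists k.
  apply: (@le_trans _ _ ((1 - q) ^+ k * (D + 1))).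
    by apply: ler_wpM2l; [rewrite exprn_ge0 // subr_ge0 | lra].
  by rewrite -ler_pdivlMr //; lra.
have [N oN] := iter k; exists N => t /oN; apply: osc_le; lra.
Qed.

Definition converges (x : nat -> 'I_n -> R) p : Prop :=
  forall e : R, 0 < e -> exists N, forall t i,
    (N <= t)%N -> i \notin F -> `|x t i - p| <= e.

(** * Convergence and drift *)

(** [p] is the infimum of the eventual upper bounds. What remains is that [p - e] is an eventual
    lower bound. The argument depends on the side of [z] on which [p] lies, since upper bounds are
    known to persist above [z] and lower bounds below it. *)
Lemma converges_exists z x d i0 : i0 \notin F -> dynamics z x d ->
  exists p, converges x p.
Proof.
move=> i0F dyn.
pose U := [set B | exists N, forall t i, (N <= t)%N -> i \notin F -> x t i <= B]%classic.
have [C xC] := bounded_above (dynamicsN dyn).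
have Ulb : has_lbound U.
  exists (- C) => B [N xB]; have := xB N i0 (leqnn _) i0F.
  by have := xC N i0 i0F; lra.
have U0 : (U !=set0)%classic.
  by have [B xB] := bounded_above dyn; exists B, 0%N => t i _; exact: xB.
set p := inf U; exists p => e e0.
have Lb0 : 0 <= L / b by exact: divr_ge0 (ltW _).
have step_small s : 0 < s -> exists N, forall t, (N <= t)%N -> L / b * alpha t <= s.
  move=> s0; have [|N aN] := alpha_small (e := s / (L / b + 1)).
    by apply: divr_gt0 => //; lra.
  exists N => t /aN; rewrite ltr_pdivlMr; last by lra.
  by have := alpha_ge0 t; lra.
have [N2 oN2] := osc_small dyn (e := e / 4) ltac:(lra).
have notU B : B < p -> ~ U B by move=> Bp /(ge_inf Ulb); rewrite -/p; lra.
have [B [N1 xB] Bp] := inf_adherent e0 (conj U0 Ulb); rewrite -/p in Bp.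
suff [N xN] : exists N, forall t i, (N <= t)%N -> i \notin F -> p - e <= x t i.
  exists (maxn N N1) => t i; rewrite geq_max => /andP[tN tN1] iF.
  by have := xB t i tN1 iF; have := xN t i tN iF; rewrite ler_norml; lra.
have [zp|pz] := ltP z p.
  have [Nd aNd] := step_small ((p - z) / 2) ltac:(lra).
  exists (maxn N2 Nd) => t i; rewrite geq_max => /andP[/oN2 ot /aNd at_] iF.
  rewrite leNgt; apply/negP => xi.
  (* By the small spread, one state below [p - e] puts all states below this maximum. The midpoint
     keeps the bound far enough above [z] to persist, yet below [p]. *)
  apply: (notU (Num.max (p - e / 2) ((z + p) / 2))); first by rewrite gt_max; lra.
  exists t => s j ts jF; apply: (stay_le dyn) ts jF; first by rewrite le_max; lra.
  by move=> k kF; rewrite le_max; have := ot k i kF iF; lra.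
have [Nd aNd] := step_small e e0.
(* Otherwise some state is below [p - e] at every late time, and the small spread makes [p - e / 2]
   an eventual upper bound. *)
have [T [TN2 TNd xT]] : exists T, [/\ (N2 <= T)%N, (Nd <= T)%N &
    forall j, j \notin F -> p - e <= x T j].
  apply: contrapT => noT; apply: (notU (p - e / 2)); first lra.
  exists (maxn N2 Nd) => t i; rewrite geq_max => /andP[tN2 tNd] iF.
  rewrite leNgt; apply/negP => xi; apply: noT; exists t; split=> // j jF.
  by have := oN2 t tN2 i j iF jF; lra.
exists T => t i Tt iF; rewrite -lerN2.
apply: (stay_le (t := T) (dynamicsN dyn)) => //; first by have := aNd T TNd; lra.
by move=> j /xT; rewrite lerN2.
Qed.

Lemma series_le (S := series alpha) t m : S (t + m)%N <= S t + m%:R * alpha t.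
Proof.
elim: m => [|m IHm]; first by rewrite addn0 mul0r addr0.
have -> : S (t + m.+1)%N = S (t + m)%N + alpha (t + m)%N.
  by rewrite /S /series /= addnS big_nat_recr.
have := alpha_dec (leq_addr m t); rewrite -natr1 mulrDl mul1r; lra.
Qed.

(** Step [t] leaves the nodes of [P] at least [c * alpha t] below [hi]. One of them is an ancestor
    of [i], and the next [n] steps carry its gap to [i]. No step goes up, so there is no additive
    error. *)
Lemma window_decrease z x d (P : {set 'I_n}) c t hi :
    dynamics z x d ->
    (forall E', reduced_graph f E F E' -> source_component F E' :&: P != finset.set0) ->
    0 <= c ->
    (forall r i, (t <= r)%N -> i \notin F -> z < x r i) ->
    (forall r i, (t <= r)%N -> i \notin F -> i \in P -> c <= d r i) ->
    (forall i, i \notin F -> x t i <= hi) ->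
  forall i, i \notin F -> x (t + n.+1)%N i <= hi - b ^+ n * c * alpha t.
Proof.
move=> dyn meetP c0 zx cd xhi i iF; have [mix _ dz] := dyn.
have d0 r j : (t <= r)%N -> j \notin F -> 0 <= alpha r * d r j.
  move=> tr jF; apply: mulr_ge0 => //.
  by have := dz r j jF; have := zx r j tr jF; nra.
have win s : between z hi F (x (t + s)%N).
  elim: s => [|s IHs] j jF; first by rewrite addn0 xhi // ltW // zx.
  have ts := leq_addr s t.
  rewrite addnS ltW /=; last by apply: zx => //; exact: leqW.
  have [_ /(_ j jF)/andP[_ v2]] := mix _ _ _ IHs.
  have : 0 <= b * (hi - x (t + s)%N j).
    by apply: mulr_ge0; [exact: ltW|have := IHs j jF; lra].
  by have := d0 (t + s)%N j ts jF; lra.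
have win' r : (t <= r)%N -> between z hi F (x r) by move=> /subnKC <-.
pose G := window_rel z hi x d.
have GF r u v : G r u v -> u \in ~: F by exact: pull_relF.
have iN : [set i]%SET \subset ~: F by rewrite finset.sub1set inE.
have [u uP ui] : exists2 u, u \in P & u \in ancestors G t.+1 n [set i]%SET.
  apply: (ancestors_meet GF); rewrite ?card_ord //.
    by apply/finset.set0Pn; exists i; rewrite inE.
  move=> r C tr rt C0 CF cl; have btr := win' r (ltnW tr).
  have [/meetP/finset.set0Pn[s /finset.setIP[ss sP]] _] := mix _ _ _ btr.
  apply/finset.set0Pn; exists s.
  by rewrite inE sP andbT (fintype.subsetP (closed_source C0 CF cl)).
have uF : u \notin F.
  by rewrite -finset.in_setC (fintype.subsetP (ancestors_sub GF _ _ iN) u ui).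
have xu : c * alpha t <= hi - x t.+1 u.
  have [_ /(_ u uF)/andP[_ v2]] := mix _ _ _ (win' t (leqnn t)).
  have : 0 <= b * (hi - x t u).
    by apply: mulr_ge0; [exact: ltW|have := xhi u uF; lra].
  have : alpha t * c <= alpha t * d t u by apply: ler_wpM2l => //; exact: cd.
  lra.
have up r k l : (t.+1 <= r)%N -> (r < t.+1 + n)%N -> l \in ~: F ->
    (k == l) || G r k l -> b * (hi - x r k) - 0 <= hi - x r.+1 l.
  move=> tr rt; rewrite inE => lF kl.
  have /andP[_] := window_pulls dyn (win' r (ltnW tr)) lF kl.
  by have := d0 r l (ltnW tr) lF; lra.
have b01 : 0 <= b <= 1 by rewrite ltW.
have [v] := ancestors_gap (gap := fun r k => hi - x r k) GF b01 (lexx _) iN up ui.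
rewrite inE => /eqP ->; rewrite mulr0 subr0 addSnnS.
have : b ^+ n * (c * alpha t) <= b ^+ n * (hi - x t.+1 u).
  by apply: ler_wpM2l => //; rewrite exprn_ge0 // ltW.
by rewrite mulrA; lra.
Qed.

Lemma series_bounded_of_drift z x d (P : {set 'I_n}) c N i0 :
    i0 \notin F -> dynamics z x d ->
    (forall E', reduced_graph f E F E' -> source_component F E' :&: P != finset.set0) ->
    0 < c ->
    (forall r i, (N <= r)%N -> i \notin F -> z < x r i) ->
    (forall r i, (N <= r)%N -> i \notin F -> i \in P -> c <= d r i) ->
  exists M, forall m, series alpha m <= M.
Proof.
move=> i0F dyn meetP c0 zx cd; set S := series alpha.
have [hi xhi] := bounded_above dyn.
(* As [alpha] is nonincreasing, one window contributes at most [n.+1 * alpha t] to the series, so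
   the upper bound drops by at least [k] times that contribution. *)
set k : R := b ^+ n * c / n.+1%:R.
have k0 : 0 < k by rewrite divr_gt0 ?mulr_gt0 ?exprn_gt0.
have main s : forall i, i \notin F ->
    x (N + s * n.+1)%N i <= hi - k * (S (N + s * n.+1)%N - S N).
  elim: s => [|s IHs] i iF; first by rewrite mul0n addn0 subrr mulr0 subr0 xhi.
  set t := (N + s * n.+1)%N in IHs *.
  have -> : (N + s.+1 * n.+1 = t + n.+1)%N by rewrite mulSn addnCA addnC.
  have Nt : (N <= t)%N by exact: leq_addr.
  have := window_decrease dyn meetP (ltW c0) _ _ IHs iF.
  have le_S := series_le t n.+1.
  have : k * (S (t + n.+1)%N - S t) <= b ^+ n * c * alpha t.
    have -> : b ^+ n * c * alpha t = k * (n.+1%:R * alpha t).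
      by rewrite /k mulrA divfK.
    by apply: ler_wpM2l; [exact: ltW | rewrite /S; lra].
  move=> le_k /(_ (fun r i tr => zx r i (leq_trans Nt tr))
                  (fun r i tr => cd r i (leq_trans Nt tr))).
  lra.
have S_homo m r : S m <= S (m + r)%N.
  elim: r => [|r IHr]; first by rewrite addn0.
  apply: le_trans IHr _; rewrite /S /series /= addnS big_nat_recr //=.
  by rewrite lerDl.
exists ((hi - z) / k + S N) => m.
have le_m : (m <= N + m * n.+1)%N by rewrite mulnS; lia.
apply: le_trans (S_homo m (N + m * n.+1 - m)%N) _; rewrite subnKC //.
rewrite -lerBlDr ler_pdivlMr //.
have := main m i0 i0F; have := zx (N + m * n.+1)%N i0 (leq_addr _ _) i0F; lra.
Qed.

Lemma convergesN x p : converges x p -> converges (fun t i => - x t i) (- p).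
Proof.
move=> cv e /cv[N xN]; exists N => t i tN iF.
by rewrite -opprD normrN xN.
Qed.

(** The drift is a product because [d * (x - z)] is unchanged by reflection, which permits assuming
    [z < p]. Near [p] the factor [x - z] is positive and bounded, so [d] is bounded below. *)
Lemma limit_eq_minimizer z x d p (P : {set 'I_n}) c N i0 :
    i0 \notin F -> dynamics z x d -> converges x p ->
    (forall E', reduced_graph f E F E' -> source_component F E' :&: P != finset.set0) ->
    0 < c ->
    (forall t i, (N <= t)%N -> i \notin F -> i \in P -> c <= d t i * (x t i - z)) ->
  p = z \/ exists M, forall m, series alpha m <= M.
Proof.
move=> i0F dyn cv meetP c0 cd.
wlog zp : z x d p dyn cv cd / z < p => [wlog_lt|].
  have [pz|zp|->] := ltgtP p z; [|exact: wlog_lt dyn cv cd zp|by left].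
  have [| |/oppr_inj ->|] := wlog_lt (- z) _ _ (- p) (dynamicsN dyn) (convergesN cv).
  - by move=> t i tN iF iP; have := cd t i tN iF iP; lra.
  - by rewrite ltrN2.
  - by left.
  - by right.
right; have [N' xN'] := cv ((p - z) / 2) ltac:(lra).
set W := (p - z) * 2.
have W0 : 0 < W by rewrite /W; lra.
have near t i : (maxn N N' <= t)%N -> i \notin F -> z < x t i /\ x t i - z <= W.
  rewrite geq_max => /andP[_ tN'] iF; have := xN' t i tN' iF.
  by rewrite ler_norml /W => ?; split; lra.
apply: (@series_bounded_of_drift z x d P (c / W) (maxn N N') i0) => //.
- exact: divr_gt0.
- by move=> t i tN iF; have [] := near t i tN iF.
move=> t i tN iF iP; have [zx xW] := near t i tN iF.
have := cd t i (leq_trans (leq_maxl _ _) tN) iF iP.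
rewrite ler_pdivrMr // => le_c; apply: le_trans le_c _.
apply: ler_wpM2l xW; have [_ _ dz] := dyn; have := dz t i iF; nra.
Qed.

End Dynamics.

(** * Subgradients and Algorithm 2 *)

Lemma local_cost_lipschitz (R : realType) (n k : nat) (L : R) (A : 'M[R]_(k, n))
    (h : 'I_k -> R -> R) (i : 'I_n) :
  assignment_matrix A -> (forall j, lipschitz_with L (h j)) ->
  lipschitz_with L (local_cost A h i).
Proof.
move=> [A0 A1] hL x y; rewrite /local_cost -sumrB.
apply: le_trans (ler_norm_sum _ _ _) _.
rewrite -[L]mul1r -(A1 i) -mulrA mulr_suml; apply: ler_sum => j _.
by rewrite -mulrBr normrM ger0_norm // ler_wpM2l // hL.
Qed.

Lemma subgradient_bound (R : realType) (L : R) (g : R -> R) (x d : R) :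
  lipschitz_with L g -> subgradient g x d -> `|d| <= L.
Proof.
move=> gL gd; have := gd (x + 1); have := gd (x - 1).
have := gL x (x + 1); have := gL x (x - 1).
rewrite !opprD !addrA !subrr !sub0r opprK normrN !normr1 mulr1.
by rewrite !ler_norml => /andP[] + + /andP[]; lra.
Qed.

(* Every h j' is minimal at z, so the subgradient at x inherits the whole excess of the single cost h j. *)
Lemma subgradient_gap (R : realType) (n k : nat) (A : 'M[R]_(k, n))
    (h : 'I_k -> R -> R) (z x d : R) (i : 'I_n) (j : 'I_k) :
  assignment_matrix A -> (forall j', argmin (h j') z) ->
  subgradient (local_cost A h i) x d ->
  A j i * (h j x - h j z) <= d * (x - z).
Proof.
move=> [A0 _] hz /(_ z) le_z.
suff : A j i * (h j x - h j z) <= local_cost A h i x - local_cost A h i z by lra.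
rewrite /local_cost -sumrB (bigD1 j) //= -mulrBr lerDl.
by apply: sumr_ge0 => l _; rewrite -mulrBr mulr_ge0 // subr_ge0; exact: hz.
Qed.

Lemma cvg_series_sqr_small (R : realType) (alpha : nat -> R) :
  (forall t, 0 <= alpha t) -> cvgn (series (fun t => alpha t ^+ 2)) ->
  forall e : R, 0 < e -> exists N, forall t, (N <= t)%N -> alpha t < e.
Proof.
move=> a0 /cvg_series_cvg_0/cvgr0Pnorm_lt cv e e0.
have [N _ aN] := cv _ (exprn_gt0 2 e0); exists N => t /aN /=.
by rewrite ger0_norm ?exprn_ge0 // ltr_pXn2r ?nnegrE // ltW.
Qed.

Lemma finite_pos_min (R : realType) (T : finType) (u : T -> R) :
  exists2 a, 0 < a & forall i, 0 < u i -> a <= u i.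
Proof.
exists (\big[Num.min/1]_(i | 0 < u i) u i); last by move=> i; exact: bigmin_le_cond.
by apply: lt_bigmin.
Qed.

Lemma algorithm2_dynamics (R : realType) (n k f : nat) (E : rel 'I_n) (L z : R)
    (h : 'I_k -> R -> R) (A : 'M[R]_(k, n)) (F : {set 'I_n}) (alpha : nat -> R)
    (x : nat -> 'I_n -> R) (msg : nat -> 'I_n -> 'I_n -> R)
    (Nst : nat -> 'I_n -> {set 'I_n}) (d : nat -> 'I_n -> R) (b : R) :
  0 <= b -> b *+ 2 * (n%:R + 1) <= 1 ->
  no_self_loops E -> (#|F| <= f)%N -> (forall j, lipschitz_with L (h j)) ->
  assignment_matrix A -> condition1 f E A -> (forall j, argmin (h j) z) ->
  algorithm2_run f E A h F alpha x msg Nst d ->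
  dynamics f E F b L alpha z x d.
Proof.
move=> b0 bn nsl Ff hL Aass c1 hz run; split=> [t lo hi bt v|t i iF|t i iF].
- have vP i : i \notin F ->
      pulls b lo hi (x t i) (v i) /\
      (#|[set u | [&& u \in in_nbrs E i, u \notin F & ~~ pulls b lo hi (x t u) (v i)]]| <= f)%N.
    move=> iF; have [tr _ xE] := run t i iF.
    have -> : v i = (#|Nst t.+1 i|%:R + 1)^-1 *
        (x t i + \sum_(j in Nst t.+1 i) received F x msg t.+1 i j).
      by rewrite /v xE subrK.
    apply: (@trimmed_pulls R n b f lo hi F (in_nbrs E i)) => //.
    + by move=> j jF; rewrite /received (negPf jF).
    (* If everything is discarded, the in-degree is at most [2f], which Condition 1 allows only for
       [f = 0]. *)
    + move=> N0; case: (posnP f) => // f0.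
      have := condition1_in_nbrs i nsl c1 f0.
      case: tr => Lo [Hi [_ [[cLo cHi NE] _]]].
      have : in_nbrs E i \subset Lo :|: Hi by rewrite -finset.setD_eq0 -NE N0.
      move=> /subset_leq_card/leq_trans/(_ (leq_card_setU _ _)).
      by rewrite cLo cHi addnn leqNgt => /negP nlt /nlt.
  split=> [|j /vP[]//]; split=> [i j /and4P[]//|j jF].
  apply: leq_trans (vP j jF).2; apply: subset_leq_card.
  apply/fintype.subsetP => i; rewrite inE => /and3P[Eij iF].
  rewrite /pull_rel Eij iF jF /= => npull.
  by rewrite inE; apply/and3P; split; rewrite // inE.
- have [_ sg _] := run t i iF; apply: subgradient_bound sg.
  exact: local_cost_lipschitz.
- have [_ /(_ z) sg _] := run t i iF.
  have : local_cost A h i z <= local_cost A h i (x t i).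
    by apply: ler_sum => j _; apply: ler_wpM2l; [exact: Aass.1 | exact: hz].
  lra.
Qed.

Theorem theorem4 (R : realType) (n k f : nat) (E : rel 'I_n)
  (L : R) (h : 'I_k -> R -> R) (A : 'M[R]_(k, n)) (F : {set 'I_n})
  (alpha : nat -> R) (x : nat -> 'I_n -> R)
  (msg : nat -> 'I_n -> 'I_n -> R) (Nst : nat -> 'I_n -> {set 'I_n})
  (d : nat -> 'I_n -> R) :
  (0 < k)%N ->
  no_self_loops E ->
  (#|F| <= f)%N ->
  (forall j, admissible L (h j)) ->
  assignment_matrix A ->
  condition1 f E A ->
  (exists y : R, forall j, argmin (h j) y) ->
  (forall t, 0 <= alpha t) ->
  (forall t, alpha t.+1 <= alpha t) ->
  (series alpha @ \oo --> +oo) ->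
  cvgn (series (fun t => alpha t ^+ 2)) ->
  algorithm2_run f E A h F alpha x msg Nst d ->
  exists2 xs : R, argmin (avg_cost h) xs &
    forall i : 'I_n, i \notin F ->
      (fun t => `|x t i - xs|) @ \oo --> 0.
Proof.
move=> k0 nsl Ff adm Aass c1 [z hz] a0 a1 adiv acv run.
have hL j : lipschitz_with L (h j) by have [] := adm j.
have L0 : 0 <= L.
  have := hL (Ordinal k0) 0 1; rewrite sub0r normrN normr1 mulr1.
  exact: le_trans.
(* An averaged value has weight at least [2 * b]; the factor 2 is what [trimmed_pulls] gives up for
   discarded values. *)
pose b : R := (2 * (n%:R + 1))^-1.
have n1 : 1 <= n%:R + 1 :> R by rewrite lerDr.
have b0 : 0 < b by rewrite invr_gt0; lra.
have bn : b *+ 2 * (n%:R + 1) <= 1.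
  have : b * (2 * (n%:R + 1)) = 1 by rewrite mulVf //; lra.
  lra.
have b1 : b <= 1 by rewrite invf_le1; lra.
have dyn := algorithm2_dynamics (ltW b0) bn nsl Ff hL Aass c1 hz run.
have adec s t : (s <= t)%N -> alpha t <= alpha s.
  move=> /subnKC <-; elim: (t - s)%N => [|r]; rewrite ?addn0 // addnS.
  exact: le_trans.
have asmall := cvg_series_sqr_small a0 acv.
have big_source E' : reduced_graph f E F E' ->
    (f < #|source_component F E'|)%N && (sp A <= #|source_component F E'|)%N.
  by move=> /(c1 F Ff); rewrite geq_max.
have source0 E' : reduced_graph f E F E' -> source_component F E' != finset.set0.
  by move=> /big_source/andP[lt_f _]; rewrite -card_gt0 (leq_ltn_trans _ lt_f).
(* Condition 1 gives the graph without [F] a nonempty source component. *)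
have [i0 i0F] : exists i0, i0 \notin F.
  have /source0 : reduced_graph f E F (restr_rel F E).
    split=> [u v /and3P[]//|v vF]; rewrite eq_card0 // => u.
    by rewrite !inE /restr_rel vF; case: (E u v); case: (u \in F).
  by case/finset.set0Pn=> i; rewrite inE => /andP[iF _]; exists i.
have [p cv] := converges_exists b0 b1 L0 a0 adec asmall source0 i0F dyn.
exists p; last first.
  move=> i iF; apply/cvgrPdist_le => e /cv[N xN]; exists N => // t /= Nt.
  by rewrite sub0r normrN normr_id xN.
suff hp j : argmin (h j) p.
  move=> y; rewrite /avg_cost ler_wpM2l ?invr_ge0 //.
  by apply: ler_sum => j _; exact: hp.
apply: contrapT => np.
have zp : h j z < h j p.
  rewrite ltNge; apply/negP => pz; apply: np => y; apply: le_trans pz _.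
  exact: hz.
pose P := [set i | 0 < A j i]%SET.
have meetP E' : reduced_graph f E F E' -> source_component F E' :&: P != finset.set0.
  move=> /big_source/andP[_ /(sp_meet j)[i iS Aji]].
  by apply/finset.set0Pn; exists i; rewrite inE iS inE.
have [a a_gt0 aA] := finite_pos_min (A j).
set eta := h j p - h j z.
have eta0 : 0 < eta by rewrite subr_gt0.
(* Within this distance of [p], the Lipschitz bound leaves [h j] at least half of its excess [eta]
   over the minimum. *)
have [N xN] := cv (eta / 2 / (L + 1)) ltac:(apply: divr_gt0; lra).
have cd t i : (N <= t)%N -> i \notin F -> i \in P ->
    a * (eta / 2) <= d t i * (x t i - z).
  move=> Nt iF; rewrite inE => Aji; have [_ sg _] := run t i iF.
  apply: le_trans (subgradient_gap j Aass hz sg).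
  have close : `|h j (x t i) - h j p| <= eta / 2.
    apply: le_trans (hL j _ _) _.
    apply: (@le_trans _ _ ((L + 1) * `|x t i - p|)).
      by apply: ler_wpM2r => //; lra.
    by rewrite mulrC -ler_pdivlMr; [exact: xN | lra].
  apply: ler_pM; [exact: ltW | lra | exact: aA |].
  by move: close; rewrite ler_norml /eta; lra.
have [pz|[M SM]] := limit_eq_minimizer b0 b1 L0 a0 adec i0F dyn cv
    meetP (mulr_gt0 a_gt0 (divr_gt0 eta0 (ltr0n _ 2))) cd.
  by move: zp; rewrite pz ltxx.
have /cvgryPge/(_ (M + 1))[m _ /(_ m (leqnn m))] := adiv.
by have := SM m => /=; lra.
Qed.
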